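(* Let $\Lambda=(\lambda_n)_{n\ge 0}$ be a sequence of positive integers with $0<\lambda_0<\lambda_1<\cdots$ and $\lambda_{n+1}/\lambda_n>2$ for all $n\ge 0$, let $\varepsilon=(\varepsilon_n)_{n\ge0}$ be a sequence with values in $\{0,1\}$, and let $\omega\in\mathbb{Z}_2$ be a $2$-adic integer. Then the formal power series $$Q_{\omega}(X)=\sum_{k\ge 0}\sigma(k,\varepsilon)\binom{\frac{\omega+k}{2}}{k}_2 X^{\mu(k,\Lambda)}$$ is a polynomial if and only if $\omega$ belongs to $\mathbb{Z}$.
   Context: Notation. For an integer $k\ge 0$ let $e_q(k)\in\{0,1\}$ be its binary digits, $k=\sum_{q\ge0}e_q(k)2^q$. For a $2$-adic integer $\omega=\sum_{i\ge0}\omega_i2^i$ ($\omega_i\in\{0,1\}$) and an integer $k\ge 0$ put $\binom{\omega}{k}_2=\prod_{i\ge0}\binom{\omega_i}{e_i(k)}\in\{0,1\}$; so it equals $1$ if $e_i(k)\le\omega_i$ for all $i$, and $0$ otherwise. By convention $\binom{\frac{\omega+k}{2}}{k}_2=0$ when $\frac{\omega+k}{2}\notin\mathbb{Z}_2$, i.e. when $\omega\not\equiv k \bmod 2$. The exponent is $\mu(k,\Lambda)=\sum_{q\ge0}e_q(k)(\lambda_q-\lambda_{q-1})$ with $\lambda_{-1}=0$. The sign is $\sigma(k,\varepsilon)=(-1)^{\nu(k)+\bar\mu(k,\varepsilon)}\in\{1,-1\}$, where $\nu(k)$ is the number of occurrences of the block $10$ in the usual binary expansion of $k$ (most significant digit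 first), and $\bar\mu(k,\varepsilon)=\sum_{q\ge0}e_q(k)(\varepsilon_q-\varepsilon_{q-1})$ with $\varepsilon_{-1}=0$. $\mathbb{Z}$ is viewed as a subring of $\mathbb{Z}_2$. *)

(* Defs.v *)
From HB Require Import structures.
From mathcomp Require Import all_boot all_order all_algebra.
From mathcomp Require Import boolp classical_sets functions cardinality fsbigop.

Set Implicit Arguments.
Unset Strict Implicit.
Unset Printing Implicit Defensive.

Import GRing.Theory.

Local Open Scope ring_scope.

(* [Z_2] is the inverse limit of the rings [Z/2^n]; [res x n] is the
   representative of [x mod 2^n] in [0, 2^n[. *)
Record adic2 := Adic2 {
  res :> nat -> nat;
  resP : forall n, res n = (res n.+1 %% 2 ^ n)%N
}.

Lemma adic2P (x y : adic2) : res x =1 res y -> x = y.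
Proof.
case: x y => [f Pf] [g Pg] /= /funext fg; case: _ / fg in Pg *.
by congr Adic2; apply: Prop_irrelevance.
Qed.

HB.instance Definition _ := gen_eqMixin adic2.
HB.instance Definition _ := gen_choiceMixin adic2.

Lemma modn_pow2S (a n : nat) : (a %% 2 ^ n.+1 = a %[mod 2 ^ n])%N.
Proof. by rewrite modn_dvdm // dvdn_exp2l. Qed.

Lemma res_mod (x : adic2) n : (x n %% 2 ^ n)%N = x n.
Proof. by rewrite resP modn_mod. Qed.

Lemma resS_mod (x : adic2) n : (x n.+1 = x n %[mod 2 ^ n])%N.
Proof. by rewrite res_mod -resP. Qed.

Fact adic2_add_subproof (x y : adic2) n :
  ((x n + y n) %% 2 ^ n = ((x n.+1 + y n.+1) %% 2 ^ n.+1) %% 2 ^ n)%N.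
Proof. by rewrite modn_pow2S -[RHS]modnDm !resS_mod modnDm. Qed.

Fact adic2_mul_subproof (x y : adic2) n :
  ((x n * y n) %% 2 ^ n = ((x n.+1 * y n.+1) %% 2 ^ n.+1) %% 2 ^ n)%N.
Proof. by rewrite modn_pow2S -[RHS]modnMm !resS_mod modnMm. Qed.

Fact adic2_nat_subproof m n : (m %% 2 ^ n = (m %% 2 ^ n.+1) %% 2 ^ n)%N.
Proof. by rewrite modn_pow2S. Qed.

Lemma res_lt (x : adic2) n : (x n < 2 ^ n)%N.
Proof. by rewrite -res_mod ltn_mod expn_gt0. Qed.

Fact adic2_opp_subproof (x : adic2) n :
  ((2 ^ n - x n) %% 2 ^ n = ((2 ^ n.+1 - x n.+1) %% 2 ^ n.+1) %% 2 ^ n)%N.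
Proof.
rewrite modn_pow2S; apply/eqP; rewrite -(eqn_modDr (x n.+1)).
rewrite subnK ?(ltnW (res_lt _ _)) // expnS modnMl.
by rewrite -modnDmr resS_mod modnDmr subnK ?modnn // ltnW ?res_lt.
Qed.

Definition adic2_add (x y : adic2) := Adic2 (adic2_add_subproof x y).
Definition adic2_mul (x y : adic2) := Adic2 (adic2_mul_subproof x y).
Definition adic2_opp (x : adic2) := Adic2 (adic2_opp_subproof x).
Definition adic2_zero := Adic2 (adic2_nat_subproof 0).
Definition adic2_one := Adic2 (adic2_nat_subproof 1).

Fact adic2_addA : associative adic2_add.
Proof. by move=> x y z; apply: adic2P => n /=; rewrite modnDmr modnDml addnA. Qed.

Fact adic2_addC : commutative adic2_add.
Proof. by move=> x y; apply: adic2P => n /=; rewrite addnC. Qed.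

Fact adic2_add0 : left_id adic2_zero adic2_add.
Proof. by move=> x; apply: adic2P => n /=; rewrite mod0n add0n res_mod. Qed.

Fact adic2_addN : left_inverse adic2_zero adic2_opp adic2_add.
Proof.
move=> x; apply: adic2P => n /=.
by rewrite modnDml subnK ?modnn ?mod0n // ltnW ?res_lt.
Qed.

Fact adic2_mulA : associative adic2_mul.
Proof. by move=> x y z; apply: adic2P => n /=; rewrite modnMmr modnMml mulnA. Qed.

Fact adic2_mulC : commutative adic2_mul.
Proof. by move=> x y; apply: adic2P => n /=; rewrite mulnC. Qed.

Fact adic2_mul1 : left_id adic2_one adic2_mul.
Proof. by move=> x; apply: adic2P => n /=; rewrite modnMml mul1n res_mod. Qed.

Fact adic2_mulD : left_distributive adic2_mul adic2_add.
Proof.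
by move=> x y z; apply: adic2P => n /=; rewrite modnMml modnDm mulnDl.
Qed.

Fact adic2_one_neq0 : adic2_one != adic2_zero.
Proof. by apply/eqP => /(congr1 (fun x : adic2 => x 1%N)). Qed.

HB.instance Definition _ :=
  GRing.isZmodule.Build adic2 adic2_addA adic2_addC adic2_add0 adic2_addN.
HB.instance Definition _ :=
  GRing.Zmodule_isComNzRing.Build adic2 adic2_mulA adic2_mulC adic2_mul1
    adic2_mulD adic2_one_neq0.

Definition adic2_digit (x : adic2) (i : nat) : bool := odd (x i.+1 %/ 2 ^ i)%N.

Lemma res_digits (x : adic2) n : x n = (\sum_(i < n) adic2_digit x i * 2 ^ i)%N.
Proof.
elim: n => [|n IHn]; first by rewrite big_ord0 -res_mod modn1.
rewrite big_ord_recr /= -IHn [X in (X + _)%N]resP addnC {1}(divn_eq (x n.+1) (2 ^ n)).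
congr (_ * _ + _)%N; rewrite /adic2_digit.
have : (x n.+1 %/ 2 ^ n < 2)%N by rewrite ltn_divLR ?expn_gt0 // -expnS res_lt.
by case: (_ %/ _)%N => [|[]].
Qed.

Definition bit (k q : nat) : bool := odd (k %/ 2 ^ q)%N.

Lemma bit_eq0 k q : (k <= q)%N -> bit k q = false.
Proof.
by move=> kq; rewrite /bit divn_small // (leq_ltn_trans kq) // ltn_expl.
Qed.

(* The products and sums over all [q >= 0] below are cut at [q < k]: by
   [bit_eq0] the remaining factors are 1 and the remaining terms are 0. *)
Definition binom2 (x : adic2) (k : nat) : nat :=
  (\prod_(i < k) 'C(adic2_digit x i, bit k i))%N.

(* [Z_2] has no 2-torsion, so there is at most one such [y]. *)
Definition adic2_half (x : adic2) : adic2 := xget 0 [set y | y *+ 2 = x]%classic.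

Definition binom2_half (omega : adic2) (k : nat) : nat :=
  if `[< exists y : adic2, y *+ 2 = omega + k%:R >]
  then binom2 (adic2_half (omega + k%:R)) k else 0%N.

Definition prev_term (a : nat -> nat) (q : nat) : nat :=
  if q is q'.+1 then a q' else 0%N.

Definition mu (k : nat) (a : nat -> nat) : int :=
  \sum_(q < k) (bit k q)%:Z * ((a q)%:Z - (prev_term a q)%:Z).

(* A block 10 is a digit 1 at some position q+1 next to a digit 0 at q. *)
Definition nu (k : nat) : nat := (\sum_(q < k) (bit k q.+1 && ~~ bit k q))%N.

Definition sigma (k : nat) (eps : nat -> bool) : int :=
  (-1) ^ ((nu k)%:Z + mu k (fun n => eps n)).

(* Coefficient of [X^n] in [Q_omega], a finite-support sum over the fibre of
   [mu] at [n].  When [lambda 0 > 0] and [lambda n.+1 > 2 * lambda n], [mu] is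
   strictly increasing in [k] and nonnegative, so that each fibre has at most
   one element and every term of the series is accounted for. *)
Definition Q_series (lambda : nat -> nat) (eps : nat -> bool) (omega : adic2)
    (n : nat) : int :=
  \sum_(k \in [set k | mu k lambda = n%:Z]%classic)
    sigma k eps * (binom2_half omega k)%:Z.

Definition is_polynomial (f : nat -> int) : Prop :=
  exists p : {poly int}, forall n, f n = p`_n.

(* Main.v *)
Require Import Defs.
From mathcomp Require Import all_boot all_order all_algebra.
From mathcomp Require Import boolp classical_sets fsbigop zify.

Import Order.TTheory GRing.Theory Num.Theory.
Local Open Scope ring_scope.

(* The increments [lambda q - lambda (q - 1)] exceed the sum of the preceding
   ones, so [mu] is strictly increasing and the series is a polynomial iff only
   finitely many [k] have a nonzero coefficient, i.e. satisfy [2 y = omega + k]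
   for some [y] whose digits dominate those of [k].
   If [omega = m] is an integer and [k > |m|], then [y = (m + k) / 2] is a natural
   number [< k], so its digits cannot dominate those of [k].
   Conversely, [k = omega mod 2^q] has a nonzero coefficient whenever the [q]-th
   digit of [omega] is 0. If these [k] are bounded, then either [omega] has
   finitely many digits 0 and is a negative integer, or its residues are
   bounded and it is a natural number. *)

(** * Residues and digits of 2-adic integers *)

Lemma res_natr (k n : nat) : (k%:R : adic2) n = (k %% 2 ^ n)%N.
Proof.
elim: k => [|k IHk]; first by [].
have -> : (k.+1%:R : adic2) n = ((1%N %% 2 ^ n + (k%:R : adic2) n) %% 2 ^ n)%N.
  by rewrite mulrS.
by rewrite IHk modnDm add1n.
Qed.

Lemma res_addn (x : adic2) (k n : nat) : (x + k%:R) n = ((x n + k) %% 2 ^ n)%N.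
Proof. by rewrite -modnDmr -(res_natr k). Qed.

Lemma adic2_digit_natr (k i : nat) : adic2_digit k%:R i = bit k i.
Proof.
rewrite /adic2_digit /bit res_natr expnS -modn_divl.
by rewrite modn2 oddb.
Qed.

Lemma resS_digit (x : adic2) n :
  x n.+1 = (x n + adic2_digit x n * 2 ^ n)%N.
Proof. by rewrite !res_digits big_ord_recr. Qed.

Lemma leq_res (x : adic2) : {homo x : m n / (m <= n)%N}.
Proof.
apply: homo_leq => [//|? ? ?|n]; first exact: leq_trans.
by rewrite resS_digit leq_addr.
Qed.

Lemma res_modn (x : adic2) m n : (m <= n)%N -> (x n %% 2 ^ m)%N = x m.
Proof.
move=> /subnKC <-; elim: (n - m)%N => [|d IHd]; first by rewrite addn0 res_mod.
by rewrite addnS resS_digit expnD mulnCA -modnDmr modnMr addn0.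
Qed.

Lemma res_mulr2n (y : adic2) n : (y *+ 2) n.+1 = (y n).*2.
Proof.
have -> : (y *+ 2) n.+1 = ((y n.+1 + y n.+1) %% 2 ^ n.+1)%N by [].
by rewrite addnn -muln2 expnSr -muln_modl -resP muln2.
Qed.

(** Halving drops the lowest digit, so the half is built from the residues [x n.+1 %/ 2], taken one
    index ahead. *)
Lemma adic2_even_half (x : adic2) : x 1%N = 0%N -> exists y : adic2, y *+ 2 = x.
Proof.
move=> x1.
have yP n : (x n.+1 %/ 2 = (x n.+2 %/ 2) %% 2 ^ n)%N.
  by rewrite modn_divl -expnSr -resP.
exists (Adic2 yP); apply: adic2P => -[|n].
  by rewrite -[LHS]res_mod -[RHS]res_mod !modn1.
rewrite res_mulr2n /= -muln2 divnK // /dvdn.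
by rewrite -[2%N]/(2 ^ 1)%N res_modn // x1.
Qed.

(** * Vanishing and nonvanishing of the coefficients *)

Lemma binom2_neq0P (y : adic2) (k : nat) :
  reflect (forall i, bit k i -> adic2_digit y i) (binom2 y k != 0%N).
Proof.
rewrite -lt0n /binom2 (big_morph _ muln_gt0 (erefl : (0 < 1)%N = true)) big_andE.
apply: (iffP forallP) => /= [k_y i k_i|k_y i].
  have ik : (i < k)%N by rewrite ltnNge; apply: contraL k_i => /bit_eq0->.
  by have := k_y (Ordinal ik); rewrite bin_gt0 /= k_i lt0b.
by rewrite bin_gt0; case: (bit k i) (k_y i) => // ->.
Qed.

Lemma binom2_half_neq0P (omega : adic2) (k : nat) :
  binom2_half omega k <> 0%N ->
  exists2 y : adic2, y *+ 2 = omega + k%:R &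
    forall i, bit k i -> adic2_digit y i.
Proof.
rewrite /binom2_half; case: asboolP => // y_ex /eqP/binom2_neq0P k_y.
by exists (adic2_half (omega + k%:R)) => //; exact: (xgetPex 0 y_ex).
Qed.

Lemma leq_dominated (y : adic2) (k n : nat) :
  (forall i, bit k i -> adic2_digit y i) -> (k < 2 ^ n)%N -> (k <= y n)%N.
Proof.
move=> k_y kn; rewrite -[k](modn_small kn) -res_natr !res_digits.
apply: leq_sum => i _; rewrite adic2_digit_natr.
by case: (bit k i) (k_y i) => // ->.
Qed.

Lemma binom2_half_int (m : int) (k : nat) :
  (`|m| < k)%N -> binom2_half m%:~R k = 0%N.
Proof.
move=> mk; case: (eqVneq (binom2_half m%:~R k) 0%N) => // /eqP.
case/binom2_half_neq0P => y + /leq_dominated k_y.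
have [t tE] : exists t : nat, t%:Z = m + k%:Z by exists (absz (m + k%:Z)); lia.
have -> : m%:~R + k%:R = t%:R :> adic2.
  by rewrite !pmulrn tE intrD.
(* Since [t < 2 * k < 2 ^ k.+1], the residue of [t] at index [k.+1] is [t] itself; hence [y k] is
   half of [t], which is less than [k] and contradicts domination. *)
move=> /(congr1 (fun x : adic2 => x k.+1)); rewrite res_mulr2n res_natr.
have kk := ltn_expl k (ltnSn 1); have := k_y k kk.
by move=> ky; rewrite modn_small ?expnS; lia.
Qed.

(** The zero digit makes [omega] congruent to [k = omega q] modulo [2 ^ q.+1], so [omega + k] is
    [2 * k] there and its half is [k] modulo [2 ^ q]. The half thus shares the digits of [k] below
    [q], and [k] has no others. *)
Lemma binom2_half_res (omega : adic2) (q : nat) :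
  adic2_digit omega q = false -> binom2_half omega (omega q) != 0%N.
Proof.
move=> omega_q; set k := omega q.
have omegaS : omega q.+1 = k by rewrite resS_digit omega_q mul0n addn0.
have y_ex : exists y : adic2, y *+ 2 = omega + k%:R.
  apply: adic2_even_half; rewrite res_addn -(res_modn omega 1 q.+1) // omegaS.
  by rewrite modnDml addnn -muln2 modnMl.
rewrite /binom2_half asboolT //; apply/binom2_neq0P => i.
set y := adic2_half _ => k_i.
have yE : y *+ 2 = omega + k%:R := xgetPex 0 y_ex.
have kq : (k < 2 ^ q)%N by exact: res_lt.
have yq : y q = k.
  have := congr1 (fun x : adic2 => x q.+1) yE; rewrite res_mulr2n res_addn omegaS.
  by rewrite addnn modn_small ?expnS; lia.
have iq : (i < q)%N.
  rewrite ltnNge; apply: contraL k_i => qi; rewrite /bit divn_small //.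
  by rewrite (leq_trans kq) // leq_exp2l.
rewrite /adic2_digit -(res_modn y i.+1 q) // yq.
by rewrite -res_natr; move: k_i; rewrite -adic2_digit_natr.
Qed.

Lemma adic2_intP (omega : adic2) (b : nat) :
  (forall q, adic2_digit omega q = false -> (omega q < b)%N) ->
  exists m : int, omega = m%:~R.
Proof.
move=> zero_b.
have [[n ones]|zeros] :=
  pselect (exists n, forall q, (n <= q)%N -> adic2_digit omega q).
  (* The digits 1 from position [n] on add up to [- 2 ^ n] in [adic2]. *)
  exists ((omega n)%:Z - (2 ^ n)%N%:Z).
  apply/eqP; rewrite intrD mulrNz -!pmulrn eq_sym subr_eq; apply/eqP.
  apply: adic2P => q.
  rewrite res_addn res_natr; have [qn|/ltnW nq] := leqP q n.
    by rewrite res_modn // -(subnKC qn) expnD -modnDmr modnMr addn0 res_mod.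
  suff -> : (omega q + 2 ^ n = omega n + 2 ^ q)%N by rewrite modnDr.
  rewrite -(subnKC nq); elim: (q - n)%N => [|d IHd]; first by rewrite addn0.
  by rewrite addnS resS_digit ones ?leq_addr // expnS; lia.
(* Zero digits now occur arbitrarily far, and residues never decrease, so the bound at a later zero
   digit covers every [q]. *)
have res_b q : (omega q < b)%N.
  apply: contrapT => bq; apply: zeros; exists q => r qr.
  apply: contraT => /negbTE/zero_b; rewrite ltnNge => /negP[].
  by rewrite (leq_trans _ (leq_res omega _ _ qr)) // leqNgt; apply/negP.
exists (omega b)%:Z; rewrite -pmulrn; apply: adic2P => q; rewrite res_natr.
have [qb|/ltnW bq] := leqP q b; first by rewrite res_modn.
(* As [omega q < b < 2 ^ b], reducing [omega q] modulo [2 ^ b] leaves it unchanged. *)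
have -> : omega b = omega q.
  rewrite -(res_modn _ _ _ bq) modn_small // (ltn_trans (res_b q)) //.
  exact: ltn_expl.
by rewrite res_mod.
Qed.

(** * Strict monotonicity of the exponent *)

Lemma bit_modn (k q n : nat) : (q < n)%N -> bit (k %% 2 ^ n) q = bit k q.
Proof.
move=> qn; rewrite -!adic2_digit_natr /adic2_digit !res_natr.
by rewrite modn_dvdm // dvdn_exp2l.
Qed.

Lemma ltn_pow2S_digit (k n : nat) : (k < 2 ^ n.+1)%N ->
  k = (k %% 2 ^ n + bit k n * 2 ^ n)%N.
Proof.
move=> kn; have : (k %/ 2 ^ n < 2)%N by rewrite ltn_divLR ?expn_gt0 // -expnS.
rewrite {2}(divn_eq k (2 ^ n)) addnC /bit.
by case: (k %/ 2 ^ n)%N => [|[|//]].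
Qed.

(** Induction on the number of digits: equal top digits reduce to the remainders modulo [2 ^ n]; if
    only [l] has top digit 1, then [d n] alone beats all the lower terms of [k]. *)
Lemma bit_sum_lt (d : nat -> int) (n k l : nat) :
  (forall q, \sum_(i < q) d i < d q) -> (k < l)%N -> (l < 2 ^ n)%N ->
  \sum_(q < n) (bit k q)%:Z * d q < \sum_(q < n) (bit l q)%:Z * d q.
Proof.
move=> d_super; have d_gt0 q : 0 < d q.
  elim/ltn_ind: q => q IHq; apply: le_lt_trans (d_super q).
  by apply: sumr_ge0 => i _; exact/ltW/IHq.
elim: n k l => [|n IHn] k l kl ln; first by lia.
have low j : \sum_(q < n) (bit (j %% 2 ^ n) q)%:Z * d q
             = \sum_(q < n) (bit j q)%:Z * d q.
  by apply: eq_bigr => i _; rewrite bit_modn.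
have IH := IHn (k %% 2 ^ n)%N (l %% 2 ^ n)%N; rewrite !low in IH.
have lD := ltn_pow2S_digit _ _ ln.
have kD := ltn_pow2S_digit _ _ (ltn_trans kl ln).
have km : (k %% 2 ^ n < 2 ^ n)%N by rewrite ltn_mod expn_gt0.
have lm : (l %% 2 ^ n < 2 ^ n)%N by rewrite ltn_mod expn_gt0.
rewrite !big_ord_recr /=.
move: kD lD; case: (bit k n); case: (bit l n) => /= kD lD.
- by rewrite ltrD2r; apply: IH => //; lia.
- by lia.
- rewrite mul0r addr0 mul1r (le_lt_trans _ (lt_le_trans (d_super n) _)) //.
    apply: ler_sum => i _; have := d_gt0 i.
    by case: (bit k i); rewrite ?mul1r ?mul0r // => /ltW.
  by rewrite lerDr sumr_ge0 // => i _; rewrite mulr_ge0 // ltW.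
- by rewrite ltrD2r; apply: IH => //; lia.
Qed.

Section Mu.
Variable lambda : nat -> nat.
Hypothesis lambda0_gt0 : (0 < lambda 0)%N.
Hypothesis lambda_double : forall n : nat, ((lambda n).*2 < lambda n.+1)%N.

Lemma mu_widen (k n : nat) : (k <= n)%N ->
  mu k lambda =
  \sum_(q < n) (bit k q)%:Z * ((lambda q)%:Z - (prev_term lambda q)%:Z).
Proof.
move=> /subnKC <-; rewrite big_split_ord /= [X in _ + X]big1 ?addr0 // => i _.
by rewrite bit_eq0 ?mul0r // leq_addr.
Qed.

Lemma mu_lt (k l : nat) : (k < l)%N -> mu k lambda < mu l lambda.
Proof.
move=> kl; rewrite (mu_widen _ _ (ltnW kl)) (mu_widen l l (leqnn l)).
apply: (bit_sum_lt (fun q => (lambda q)%:Z - (prev_term lambda q)%:Z) l) => //;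
  [move=> q|exact: ltn_expl].
(* The increments telescope, so the growth condition becomes [2 * lambda (q - 1) < lambda q], or
   [0 < lambda 0] when [q = 0]. *)
suff -> : \sum_(i < q) ((lambda i)%:Z - (prev_term lambda i)%:Z)
  = (prev_term lambda q)%:Z.
  by case: q => [|q] /=; [|have := lambda_double q]; lia.
elim: q => [|q IHq]; first by rewrite big_ord0.
by rewrite big_ord_recr /= IHq addrC subrK.
Qed.

(** This makes exponents nonnegative and turns a bound on the degree into a bound on [k]. *)
Lemma leq_mu (k : nat) : k%:Z <= mu k lambda.
Proof.
elim: k => [|k IHk]; first by rewrite /mu big_ord0.
by have := mu_lt k k.+1 (ltnSn k); lia.
Qed.

Lemma mu_inj : injective (mu^~ lambda).
Proof.
by move=> k l /= kl; case: (ltngtP k l) => // /mu_lt; rewrite kl ltxx.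
Qed.

Lemma Q_series_mu (eps : nat -> bool) (omega : adic2) (n k : nat) :
  mu k lambda = n%:Z ->
  Q_series lambda eps omega n = sigma k eps * (binom2_half omega k)%:Z.
Proof.
move=> kn; rewrite /Q_series.
suff -> : [set l | mu l lambda = n%:Z]%classic = [set k]%classic.
  by rewrite fsbig_set1.
by apply/seteqP; split=> l /= => [|->//]; rewrite -kn => /mu_inj.
Qed.

End Mu.

Lemma sigma_neq0 (k : nat) (eps : nat -> bool) : sigma k eps != 0.
Proof.
by rewrite /sigma; case: (_ + _) => n; rewrite ?invr_eq0 signr_eq0.
Qed.

Theorem theorem3 (lambda : nat -> nat) (eps : nat -> bool) (omega : adic2)
    (lambda0_gt0 : (0 < lambda 0)%N)
    (lambda_incr : forall n : nat, (lambda n < lambda n.+1)%N)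
    (lambda_ratio : forall n : nat, 2 < (lambda n.+1)%:Q / (lambda n)%:Q) :
  is_polynomial (Q_series lambda eps omega) <-> exists m : int, omega = m%:~R.
Proof.
have lambda_gt0 n : (0 < lambda n)%N.
  by case: n => // n; rewrite (leq_ltn_trans _ (lambda_incr n)).
have lambda_double n : ((lambda n).*2 < lambda n.+1)%N.
  have := lambda_ratio n; rewrite ltr_pdivlMr ?ltr0z ?ltz_nat ?lambda_gt0 //.
  by rewrite -!pmulrn -natrM ltr_nat mul2n.
split=> [[p pE]|[m ->]].
  apply: (adic2_intP _ (size p)) => q /binom2_half_res.
  set k := omega q => k_neq0.
  have [n nE] : exists n : nat, mu k lambda = n%:Z.
    by exists `|mu k lambda|%N; have := leq_mu _ lambda0_gt0 lambda_double k; lia.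
  have : p`_n != 0.
    rewrite -pE (Q_series_mu _ lambda0_gt0 lambda_double _ _ _ _ nE).
    by rewrite mulf_neq0 ?sigma_neq0.
  have := leq_mu _ lambda0_gt0 lambda_double k; rewrite nE lez_nat => kn.
  by apply: contraNltn => /leq_trans/(_ kn)/leq_sizeP->.
(* By monotonicity, an exponent at least [b] can only come from some [k] above the absolute value of
   [m], where the coefficient vanishes. *)
pose b := `|mu `|m| lambda|%N.+1.
exists (\poly_(n < b) Q_series lambda eps m%:~R n) => n.
rewrite coef_poly; case: ltnP => // bn; rewrite /Q_series fsbig1 // => k /= kn.
have [/binom2_half_int->|km] := ltnP `|m| k; first by rewrite mulr0.
suff : mu k lambda <= mu `|m| lambda by move: bn; rewrite /b kn; lia.
move: km; rewrite leq_eqVlt => /predU1P[->//|].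
by move=> /(mu_lt _ lambda0_gt0 lambda_double)/ltW.
Qed.
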